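(* For each fixed $k\in\mathbb N$, the following statements are equivalent. $(\mathrm C)_k$: Every $A\subseteq\mathbb N$ with $d^*(A)>0$ admits an infinite $B\subseteq\mathbb N$ and $t\in\mathbb Z_+$ such that $B^{\oplus k}\subseteq A-t$. $(\mathrm D)_k$: For every system $(X,\mu,T)$, every F{\o}lner sequence $\Phi$ in $\mathbb N$, every $a\in\operatorname{gen}(\mu,\Phi)$, and every open $E\subseteq X$ with $\mu(E)>0$, there exist $p\in\mathcal A(X,T)$ and $t\in\mathbb Z_+$ such that $p^ka\in T^{-t}E$.
   Context: $\mathbb N=\{1,2,\ldots\}$, $\mathbb Z_+=\{0,1,2,\ldots\}$. For $C\subseteq\mathbb N$ and $t\in\mathbb Z_+$, $C-t:=\{n\in\mathbb N:n+t\in C\}$. $B^{\oplus k}:=\{\sum_{n\in F}n:F\subseteq B,\ |F|=k\}$. Upper Banach density: $d^*(A)=\limsup_{N\to\infty}\sup_{M\in\mathbb Z_+}\frac{|A\cap\{M+1,\ldots,M+N\}|}{N}$. A F{\o}lner sequence in $\mathbb N$ is a sequence $\Phi=(\Phi_N)_{N\in\mathbb N}$ of nonempty finite subsets of $\mathbb N$ with $\lim_{N\to\infty}|(\Phi_N-h)\cap\Phi_N|/|\Phi_N|=1$ for every $h\in\mathbb N$. A system is a triple $(X,\mu,T)$ with $X$ a compact metric space, $T$ a homeomorphism of $X$, and $\mu$ a $T$-invariant Borel probability measure. $a\in\operatorname{gen}(\mu,\Phi)$ means $\mu=\lim_{N\to\infty}\frac1{|\Phi_N|}\sum_{n\in\Phi_N}\delta_{T^na}$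 in the weak-star topology. The adherence semigroup is $\mathcal A(X,T)=\bigcap_{m=1}^{\infty}\overline{\{T^n:n\ge m\}}$, with closures in $X^X$ under pointwise convergence; elements are multiplied by composition. *)

(* Defs.v *)
From HB Require Import structures.
From mathcomp Require Import all_boot all_order all_algebra finmap.
From mathcomp Require Import all_classical all_reals all_analysis.

Set Implicit Arguments.
Unset Strict Implicit.
Unset Printing Implicit Defensive.

Import Order.TTheory GRing.Theory Num.Theory.
Import numFieldNormedType.Exports.

Local Open Scope classical_set_scope.
Local Open Scope ring_scope.

(* Subsets of {1, 2, ...} are sets [A : set nat] with [A `<=` posN];
   elements of {0, 1, 2, ...} are plain elements of [nat]. *)
Definition posN : set nat := [set n | (0 < n)%N].

Definition shiftN (C : set nat) (t : nat) : set nat :=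
  [set n | posN n /\ C (n + t)%N].

Definition ksums (B : set nat) (k : nat) : set nat :=
  [set (\sum_(n <- F) n)%N | F in
     [set F : {fset nat} | [set` F] `<=` B /\ #|` F|%fset = k]].

(* The term N = 0 is a junk value 0 / 0 and does not affect the limsup. *)
Definition upper_banach_density (R : realType) (A : set nat) : \bar R :=
  limn_esup (fun N => ereal_sup (range (fun M =>
    ((#|` fset_set (A `&` [set n | (M.+1 <= n <= M + N)%N])|%fset)%:R
       / N%:R)%:E))).

(* Sequences indexed by {1, 2, ...} are reindexed to start at 0. *)
Definition is_folner (R : realType) (Phi : nat -> {fset nat}) : Prop :=
  (forall N, [set` Phi N] `<=` posN /\ Phi N != fset0) /\
  (forall h, (0 < h)%N ->
    (fun N =>
       (#|` fset_set (shiftN [set` Phi N] h `&` [set` Phi N])|%fset)%:R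
         / (#|` Phi N|%fset)%:R : R) @ \oo --> (1 : R)).

(* The library attaches a sigma-algebra only to pointed types; the spaces of
   interest carry a probability measure, hence are nonempty anyway. *)
#[short(type="pmetricType")]
HB.structure Definition PointedMetric (K : numDomainType) :=
  { M of Metric K M & isPointed M }.

Notation borel X := (g_sigma_algebraType (@open X)).

Definition is_homeomorphism (X : topologicalType) (T : X -> X) : Prop :=
  continuous T /\
  exists S : X -> X, [/\ cancel T S, cancel S T & continuous S].

Definition is_system (R : realType) (X : pmetricType R)
    (mu : probability (borel X) R) (T : X -> X) : Prop :=
  [/\ compact [set: X],
      is_homeomorphism T &
      forall A : set (borel X), measurable A -> mu (T @^-1` A) = mu A].

Definition empirical_measure (R : realType) (X : pmetricType R)
    (T : X -> X) (a : X) (F : {fset nat}) :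
    {measure set (borel X) -> \bar R} :=
  mscale ((#|` F|%fset)%:R^-1)%:nng
    (msum (fun i => dirac (iter (nth 0%N F i) T a : borel X)) #|` F|%fset).

Definition weak_star_cvg (R : realType) (X : pmetricType R)
    (nu : nat -> {measure set (borel X) -> \bar R})
    (mu : {measure set (borel X) -> \bar R}) : Prop :=
  forall f : X -> R, continuous f ->
    (fun N => Rintegral (nu N) setT f) @ \oo --> Rintegral mu setT f.

Definition generic (R : realType) (X : pmetricType R)
    (mu : probability (borel X) R) (T : X -> X) (Phi : nat -> {fset nat}) :
    set X :=
  [set a | weak_star_cvg (fun N => empirical_measure T a (Phi N)) mu].

Definition adherence_semigroup (X : topologicalType) (T : X -> X) :
    set {ptws X -> X} :=
  \bigcap_(m in posN)
    closure [set (iter n T : {ptws X -> X}) | n in [set n | (m <= n)%N]].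

(* Main.v *)
(** (C) implies (D): a continuous function vanishing exactly outside [E] has
    positive integral [c], so the orbit of [a] visits the superlevel set [> c/2]
    along a positive proportion of [Phi]; averaging windows based at the points of
    a Folner set turns this into positive upper Banach density.  If [p] is a limit
    of the iterates of [T] along a nonprincipal ultrafilter containing [B], then
    [T^t p^k a] is an iterated limit of the points [T^(t + n_1 + ... + n_k) a] with
    distinct [n_i] in [B], all of which lie in a closed subset of [E].

    (D) implies (C): Furstenberg correspondence for the two-sided shift.  The
    invariant measure is the extension of an ultralimit of empirical frequencies
    of cylinders; there are finitely many cylinders of each level, so a diagonal
    choice makes the frequencies converge along an honest sequence of intervals.
    The set [B] is then built greedily: as [p] is approximated pointwise by
    arbitrarily late iterates of [T], one copy of [p] at a time can be traded for
    a new element of [B]. *)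
Require Import Defs.
From HB Require Import structures.
From mathcomp Require Import all_boot all_order all_algebra finmap.
From mathcomp Require Import all_classical all_reals all_analysis.
From mathcomp Require Import measurable_realfun lra zify.
Import Order.TTheory GRing.Theory Num.Theory.
Import numFieldNormedType.Exports.
Local Open Scope classical_set_scope.
Local Open Scope ring_scope.

Set Implicit Arguments.
Unset Strict Implicit.
Unset Printing Implicit Defensive.

(** * Empirical averages and measures *)

Definition avg (R : realType) (F : {fset nat}) (g : nat -> R) : R :=
  (#|` F|%fset)%:R^-1 * \sum_(n <- F) g n.

Lemma avgD (R : realType) (F : {fset nat}) (g h : nat -> R) :
  avg F (fun n => g n + h n) = avg F g + avg F h.
Proof. by rewrite /avg big_split mulrDr. Qed.

Lemma avgZ (R : realType) (F : {fset nat}) (c : R) (g : nat -> R) :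
  avg F (fun n => c * g n) = c * avg F g.
Proof. by rewrite /avg -mulr_sumr mulrCA. Qed.

Lemma avg_cst (R : realType) (F : {fset nat}) (c : R) :
  F != fset0 -> avg F (fun=> c) = c.
Proof.
move=> F0; rewrite /avg big_const_seq count_predT iter_addr addr0 -[c *+ _]mulr_natl.
by rewrite mulKf// pnatr_eq0 -lt0n cardfs_gt0.
Qed.

Lemma le_avg (R : realType) (F : {fset nat}) (g h : nat -> R) :
  (forall n, g n <= h n) -> avg F g <= avg F h.
Proof. by move=> gh; rewrite ler_wpM2l// ler_sum. Qed.

Lemma continuous_borel_measurable (R : realType) (X : pmetricType R)
    (f : X -> R) :
  continuous f -> measurable_fun [set: borel X] (f : borel X -> R).
Proof.
move=> cf; apply: (measurability _ (RGenOpens.measurableE R)).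
move=> _ [_ [a [b ->]] <-]; rewrite setTI; apply: sub_sigma_algebra.
by apply: (open_comp (fun x _ => cf x)); exact: interval_open.
Qed.

(** Integration against a scaled finite sum of Dirac masses is a finite average. The additivity in
    the measure is applied to nonnegative functions, so [f] is split into its positive and negative
    parts. *)
Lemma Rintegral_empirical (R : realType) (X : pmetricType R) (T : X -> X)
    (a : X) (F : {fset nat}) (f : X -> R) :
  measurable_fun [set: borel X] (f : borel X -> R) ->
  Rintegral (empirical_measure T a F) setT f = avg F (fun n => f (iter n T a)).
Proof.
move=> mf.
have key (g : borel X -> R) : measurable_fun setT g -> (forall x, 0 <= g x) ->
    (\int[empirical_measure T a F]_x (g x)%:E)%E =
    (avg F (fun n => g (iter n T a)))%:E.
  move=> mg g0.
  rewrite ge0_integral_mscale//; last 2 first.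
    exact/measurable_EFinP.
    by move=> x _; rewrite lee_fin.
  rewrite ge0_integral_measure_sum//; last 2 first.
    by move=> x _; rewrite lee_fin.
    exact/measurable_EFinP.
  rewrite /avg EFinM; congr (_ * _)%E.
  rewrite (big_nth 0%N) big_mkord -sumEFin; apply: eq_bigr => i _.
  rewrite integral_dirac//; last exact/measurable_EFinP.
  by rewrite diracT mul1e.
rewrite /Rintegral integralE (funerpos f) (funerneg f) !key; first last.
- exact: funrpos_ge0.
- exact: measurable_funrpos.
- exact: funrneg_ge0.
- exact: measurable_funrneg.
rewrite -EFinB /= /avg -mulrBr -sumrB; congr (_ * _); apply: eq_bigr => i _.
by rewrite -[in RHS](funrposBneg f).
Qed.

(** * Density along Folner sequences *)

Definition window (A : set nat) (M N : nat) : set nat :=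
  A `&` [set n | (M.+1 <= n <= M + N)%N].

Lemma fset_set_window (A : set nat) (M N : nat) :
  fset_set (window A M N) = [fset n in iota M.+1 N | n \in A]%fset.
Proof.
apply/fsetP => n; rewrite in_fset_set; last first.
  by apply: finite_setIr; apply: (@sub_finite_set _ _ `I_(M + N).+1) => // m /= /andP[].
rewrite !inE /= mem_iota; apply/idP/idP.
  by rewrite inE => -[An /= /andP[h1 h2]]; rewrite mem_set// andbT addSn ltnS h1.
by move=> /andP[/andP[h1 h2] /set_mem An]; rewrite inE; split => //=; rewrite h1 -ltnS.
Qed.

Lemma card_window (A : set nat) (M N : nat) :
  #|` fset_set (window A M N)|%fset = (\sum_(h < N) ((M + h.+1)%N \in A))%N.
Proof.
have -> : fset_set (window A M N) = [fset n in [seq n <- iota M.+1 N | n \in A]]%fset.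
  by rewrite fset_set_window; apply/fsetP => n; rewrite !inE /= mem_filter andbC.
rewrite card_fseq undup_id ?filter_uniq ?iota_uniq// size_filter -sumn_count.
rewrite sumnE big_map -[M.+1]addn0 iotaDl big_map.
rewrite (_ : iota 0 N = index_iota 0 N); last by rewrite /index_iota subn0.
rewrite big_mkord; apply: eq_bigr => h _.
by rewrite addSnnS.
Qed.

(** The limsup is an infimum over tails of suprema, and every tail contains a positive length, whose
    supremum over windows is at least [c]. *)
Lemma upper_banach_density_gt0 (R : realType) (A : set nat) (c : R) : 0 < c ->
  (forall N, (0 < N)%N ->
     exists M, c <= (#|` fset_set (window A M N)|%fset)%:R / N%:R) ->
  (0 < upper_banach_density R A)%E.
Proof.
move=> c0 H; apply: (@lt_le_trans _ _ c%:E); first by rewrite lte_fin.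
apply: le_ereal_inf_tmp => _ [V [n _ nV] <-].
have [M HM] := H n.+1 isT.
apply: le_ereal_sup_tmp; exists (ereal_sup (range (fun M =>
    ((#|` fset_set (window A M n.+1)|%fset)%:R / n.+1%:R : R)%:E))).
  by exists n.+1 => //; apply: nV => /=.
by apply: le_ereal_sup_tmp; eexists; [exists M; first by []; reflexivity|rewrite lee_fin].
Qed.

(** Double counting of the pairs [(m, h)] with [m] in [Phi N], [h < L] and [m + h.+1] in [A]. For
    each [h] there are at least [c / 2] times [#|Phi N|] of them, so some window of length [L] based
    at a point [m] has density at least [c / 2]. *)
Lemma folner_banach (R : realType) (Phi : nat -> {fset nat}) (A : set nat) (c : R) :
  is_folner R Phi -> 0 < c ->
  (\forall N \near \oo, c <= avg (Phi N) (fun n => (n \in A)%:R)) ->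
  (0 < upper_banach_density R A)%E.
Proof.
move=> [Phi_pos Phi_fol] c0 HA.
apply: (@upper_banach_density_gt0 _ _ (c / 2)); first by rewrite divr_gt0.
move=> L L0.
pose S (F : {fset nat}) h := [fset m in F | (m + h)%N \in F]%fset.
(* Finitely many shifts occur, so one [N] serves them all: each shift pushes at most a fraction
   [c / 2] of [Phi N] out of it, which leaves [c - c / 2] for [A]. *)
have HS : \forall N \near \oo, forall h : 'I_L,
    (1 - c / 2) * (#|` Phi N|%fset)%:R <= (#|` S (Phi N) h.+1|%fset)%:R.
  apply: filter_forall => h; near=> N.
  have [PN0 PNn0] := Phi_pos N.
  have F0 : 0 < (#|` Phi N|%fset)%:R :> R by rewrite ltr0n cardfs_gt0.
  have -> : S (Phi N) h.+1 =
     fset_set (shiftN [set` Phi N] h.+1 `&` [set` Phi N]).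
    apply/fsetP => m; rewrite in_fset_set; last first.
      by apply: finite_setIr; exact: finite_fset.
    rewrite !inE /=; apply/idP/idP.
      by move=> /andP[mF mhF]; rewrite inE; split=> //; split => //; exact: PN0.
    by rewrite inE => -[[_ /= ->] /= ->].
  rewrite -ler_pdivlMr// ltW//.
  near: N.
  apply: (cvgr_gt (1:R) (Phi_fol h.+1 isT)).
  by rewrite ltrBlDr ltrDl divr_gt0.
have [N [HAN HSN]] : exists N, c <= avg (Phi N) (fun n => (n \in A)%:R) /\
  forall h : 'I_L, (1 - c / 2) * (#|` Phi N|%fset)%:R <= (#|` S (Phi N) h.+1|%fset)%:R.
  by near \oo => N; exists N; split; near: N.
have [PN0 PNn0] := Phi_pos N.
have F0 : 0 < (#|` Phi N|%fset)%:R :> R by rewrite ltr0n cardfs_gt0.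
move: (Phi N) HAN HSN PNn0 F0 => F HAF HSF Fn0 F0.
pose AF := [fset n in F | n \in A]%fset.
pose Ah h := [fset m in F | (m + h)%N \in A]%fset.
have sumcard (P : pred nat) : (\sum_(n <- F) (P n : nat))%N = #|` [fset n in F | P n]|%fset.
  rewrite -[RHS]/(size (enum_fset _)).
  have -> : size (enum_fset [fset n in F | P n]%fset) = size [seq n <- F | P n].
    apply: perm_size; apply: uniq_perm; rewrite ?filter_uniq ?fset_uniq// => n.
    by rewrite mem_filter !inE /= andbC.
  by rewrite size_filter -sumn_count sumnE big_map.
(* Both [AF] and the translate of [S F h] lie in [F], and a point common to them
   is the translate of a point of [Ah h]. *)
have key h : (#|` AF| + #|` S F h| <= #|` Ah h| + #|` F|)%N%fset.
  have inj : injective (addn^~ h) by exact: addIn.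
  have cardsh (G : {fset nat}) : #|` G|%fset = #|` [fset (m + h)%N | m in G]|%fset.
    by rewrite card_imfset.
  rewrite (cardsh (S F h)) (cardsh (Ah h)).
  rewrite -cardfsUI addnC leq_add//; apply: fsubset_leq_card.
    apply/fsubsetP => n; rewrite !inE => /andP[/andP[nF nA]].
    move=> /imfsetP[/= m]; rewrite !inE => /andP[mF mhF] nE.
    by apply/imfsetP; exists m => //=; rewrite !inE mF -nE nA.
  apply/fsubsetP => n; rewrite !inE => /orP[/andP[]//|].
  by move=> /imfsetP[/= m]; rewrite !inE => /andP[mF mhF] ->.
apply: contrapT => /forallNP Hc.
have Hlt M : \sum_(h < L) ((M + h.+1)%N \in A)%:R < L%:R * (c / 2).
  rewrite ltNge; apply/negP => hM; apply: (Hc M).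
  by rewrite card_window ler_pdivlMr ?ltr0n// mulrC natr_sum.
have : \sum_(m <- F) \sum_(h < L) ((m + h.+1)%N \in A)%:R <
    (#|` F|%fset)%:R * (L%:R * (c / 2)).
  have -> : (#|` F|%fset)%:R * (L%:R * (c / 2)) = \sum_(m <- F) (L%:R * (c / 2)).
    by rewrite big_const_seq count_predT iter_addr addr0 mulr_natl.
  apply: ltr_sum => // .
  by rewrite has_predT cardfs_gt0.
apply/negP; rewrite -leNgt exchange_big /=.
have -> : (#|` F|%fset)%:R * (L%:R * (c / 2)) = \sum_(h < L) ((#|` F|%fset)%:R * (c / 2)).
  by rewrite sumr_const card_ord -mulr_natl; lra.
apply: ler_sum => h _.
rewrite -natr_sum sumcard.
have := key h.+1; rewrite -(ler_nat R) !natrD.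
have := HSF h.
have : c * (#|` F|%fset)%:R <= (#|` AF|%fset)%:R.
  by move: HAF; rewrite /avg -natr_sum sumcard ler_pdivlMl// mulrC.
rewrite -/(Ah h.+1).
lra.
Unshelve. all: by end_near.
Qed.

(** * Visits of generic points to open sets *)

(** [g] is the distance to the complement of [E] truncated at 1. Adjoining 1 to the set of distances
    also keeps the infimum meaningful when the complement is empty. *)
Lemma open_continuous_gt0 (R : realType) (X : metricType R) (E : set X) :
  open E -> exists g : X -> R, [/\ continuous g, forall x, 0 <= g x <= 1 &
    forall x, (0 < g x) <-> E x].
Proof.
move=> oE.
pose S x : set R := 1 |` [set mdist x y | y in ~` E].
pose g x := inf (S x).
have S0 x : S x !=set0 by exists 1; left.
have lb0 x : lbound (S x) 0.
  by move=> _ [->|[y _ <-]]; [exact: ler01|exact: mdist_ge0].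
have hlb x : has_lbound (S x) by exists 0.
have g0 x : 0 <= g x by apply: lb_le_inf.
have lip x y : g x <= g y + mdist x y.
  rewrite -lerBlDr; apply: lb_le_inf => // _ [->|[z Ez <-]].
    rewrite lerBlDr (@le_trans _ _ 1)//; last by rewrite lerDl mdist_ge0.
    by apply: ge_inf => //; left.
  rewrite lerBlDr addrC (le_trans _ (metric_triangle x y z))//.
  by apply: ge_inf => //; right; exists z.
exists g; split.
- move=> x; apply/cvgrPdist_lt => e e0.
  have : nbhs x (ball x e) by exact: nbhsx_ballx.
  apply: filterS => y; rewrite ballEmdist /= => xy.
  have := lip x y; have := lip y x; rewrite (metric_sym y x) => h1 h2.
  by rewrite ltr_norml; lra.
- by move=> x; rewrite g0 /=; apply: ge_inf => //; left.
- move=> x; split.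
    apply: contraPP => nEx; apply/negP; rewrite -leNgt.
    by apply: ge_inf => //; right; exists x => //; exact: mdistxx.
  move=> Ex; have /nbhs_ballP[e /= e0 eE] : nbhs x E by exact: open_nbhs_nbhs.
  apply: (@lt_le_trans _ _ (Num.min 1 e)); first by rewrite lt_min ltr01.
  apply: lb_le_inf => // _ [->|[y nEy <-]]; first by rewrite ge_min lexx.
  rewrite ge_min; apply/orP; right; rewrite leNgt; apply/negP => xy.
  by apply: nEy; apply: eE; rewrite ballEmdist.
Qed.

Lemma probability_bounded_integrable d (S : measurableType d) (R : realType)
    (mu : probability S R) (f : S -> R) (M : R) :
  measurable_fun setT f -> (forall x, `|f x| <= M) ->
  mu.-integrable setT (EFin \o f).
Proof.
move=> mf fM; apply: measurable_bounded_integrable => //.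
  by rewrite -ge0_fin_numE// fin_num_measure.
by exists M; split; [exact: num_real|move=> N MN x _; exact: le_trans (fM x) (ltW MN)].
Qed.

(** A nonnegative function with zero integral vanishes almost everywhere, so its positivity set
    would be null. *)
Lemma Rintegral_gt0 d (S : measurableType d) (R : realType)
    (mu : probability S R) (f : S -> R) :
  measurable_fun setT f -> (forall x, 0 <= f x <= 1) ->
  (0 < mu [set x | 0 < f x]%R)%E -> 0 < Rintegral mu setT f.
Proof.
move=> mf f01 mu0.
have if_ : mu.-integrable setT (EFin \o f).
  apply: (@probability_bounded_integrable _ _ _ _ _ 1) => // x.
  by have /andP[? ?] := f01 x; rewrite ger0_norm.
rewrite lt_neqAle; apply/andP; split; last first.
  by apply: Rintegral_ge0 => x _; have /andP[] := f01 x.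
apply/negP => /eqP/esym I0.
have : (\int[mu]_x (f x)%:E = 0)%E.
  by rewrite -[LHS]fineK//; [congr EFin|exact: integrable_fin_num].
have -> : (\int[mu]_x (f x)%:E = \int[mu]_x `|(f x)%:E|)%E.
  by apply: eq_integral => x _; have /andP[? _] := f01 x; rewrite gee0_abs// lee_fin.
move/ae_eq_integral_abs => /(_ measurableT); case.
  exact/measurable_EFinP.
move=> N [mN N0 sN]; move: mu0; rewrite ltNge => /negP; apply.
rewrite -N0; apply: le_measure; rewrite ?inE//.
  rewrite -[X in measurable X]setTI -[X in _ `&` X]/(f @^-1` [set y | 0 < y]).
  rewrite (_ : [set y | 0 < y] = `]0, +oo[%classic); last first.
    by apply/seteqP; split => y /=; rewrite in_itv /= andbT.
  exact: mf.
move=> x /= fx; apply: sN => /= /(_ I) [fx0].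
by rewrite fx0 ltxx in fx.
Qed.

Lemma generic_visits (R : realType) (X : pmetricType R)
    (mu : probability (borel X) R) (T : X -> X) (Phi : nat -> {fset nat})
    (a : X) (E : set X) :
  is_folner R Phi -> generic mu T Phi a -> open E -> (0 < mu E)%E ->
  exists E' K : set X, [/\ E' `<=` K, closed K, K `<=` E &
    (0 < upper_banach_density R [set n | (0 < n)%N /\ E' (iter n T a)])%E].
Proof.
move=> fol gen oE E0.
have [g [cg g01 gE]] := open_continuous_gt0 oE.
have mg := continuous_borel_measurable cg.
pose c := Rintegral mu setT g.
have c0 : 0 < c.
  apply: Rintegral_gt0 => //.
  by rewrite (_ : [set x | 0 < g x]%R = E)//; apply/seteqP; split => x /gE.
exists [set x | c / 2 < g x], [set x | c / 2 <= g x]; split.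
- by move=> x /= /ltW.
- by apply: (@closed_comp _ _ g [set y | c / 2 <= y]) => [x _|]; [exact: cg|exact: closed_ge].
- by move=> x /= gx; apply/gE; lra.
(* The averages of [g] eventually exceed [3c / 4], and [g] is at most [c / 2] plus the indicator of
   the visiting times along [Phi N]; this leaves [c / 4]. *)
apply: (folner_banach (c := c / 4) fol); first lra.
have := gen g cg; rewrite -/c => /cvgrPdist_lt /(_ (c / 4)).
have c4 : 0 < c / 4 by lra.
move=> /(_ c4); apply: filterS => N.
rewrite Rintegral_empirical// ltr_norml => /andP[_ h].
have [PN0 PNn0] := fol.1 N.
have F0 : 0 < (#|` Phi N|%fset)%:R :> R by rewrite ltr0n cardfs_gt0.
set A := [set n | _].
have : avg (Phi N) (fun n => g (iter n T a)) <= c / 2 + avg (Phi N) (fun n => (n \in A)%:R).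
  rewrite /avg ler_pdivrMl// mulrDr mulVKf ?gt_eqF//.
  have -> : (#|` Phi N|%fset)%:R * (c / 2) = \sum_(m <- Phi N) (c / 2).
    by rewrite big_const_seq count_predT iter_addr addr0 mulr_natl.
  rewrite -big_split /= big_seq [leRHS]big_seq; apply: ler_sum => n nP.
  have [gc|gc] := leP (g (iter n T a)) (c / 2).
    by rewrite (le_trans gc)// lerDl.
  rewrite mem_set//; last by split => //; exact: PN0.
  have /andP[_ g1] := g01 (iter n T a).
  by rewrite (le_trans g1)// lerDr; lra.
lra.
Qed.

(** * Limits of iterates along ultrafilters *)

Lemma continuous_iter (X : topologicalType) (T : X -> X) :
  continuous T -> forall n, continuous (iter n T).
Proof.
move=> cT; elim=> [|n IH] x /=; first exact: cvg_id.
by apply: continuous_comp; [exact: IH|exact: cT].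
Qed.

Lemma adherence_ksums (R : realType) (X : pmetricType R) (T : X -> X) (a : X)
    (K : set X) (B : set nat) (k t : nat) :
  compact [set: X] -> continuous T -> closed K -> infinite_set B ->
  (forall n, ksums B k n -> K (iter (n + t) T a)) ->
  exists p : {ptws X -> X},
    adherence_semigroup T p /\ K (iter t T (iter k (p : X -> X) a)).
Proof.
move=> cX cT cK iB HB.
have cTn := continuous_iter cT.
(* Infinitude of [B] is what makes its intersections with tails nonempty. *)
have GF : ProperFilter (within B \oo).
  split; last exact: within_filter.
  move=> [n _ /= Bn]; apply: iB.
  apply: (@sub_finite_set _ _ `I_n) => // m Bm /=.
  by rewrite ltnNge; apply/negP => nm; exact: (Bn m nm).
have [U [UU GU]] := ultraFilterLemma GF.
have UB : U B by apply: GU; exists 0%N.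
have Uge m : U [set n | (m <= n)%N] by apply: GU; exists m => // n mn.
have lim_ex x : exists y : X, iter n T x @[n --> U] --> y.
  have [y [_ cy]] := cX _ (fmap_proper_filter (fun n => iter n T x) ultra_proper) filterT.
  exists y => V Vy; have [//|UV] := in_ultra_setVsetC ((fun n => iter n T x) @^-1` V) UU.
  by have [z [nVz Vz]] := cy (~` V) V UV Vy.
pose p : X -> X := fun x => projT1 (cid (lim_ex x)).
have pE x : iter n T x @[n --> U] --> p x by exact: (projT2 (cid (lim_ex x))).
exists p; split.
  move=> m _ V Vp.
  have : U [set n | V (iter n T : {ptws X -> X})].
    have pU : {ptws, (fun n => iter n T) @ U --> p} by apply/pointwise_cvgP.
    exact: pU.
  move=> UV; have [n [/= Vn mn]] := filter_ex (filterI UV (Uge m)).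
  by exists (iter n T); split => //; exists n.
(* Induction on the number [i] of factors [p] applied to [a]; the other [k - i] factors have become
   distinct elements of [B], collected in [F]. *)
suff key i (F : {fset nat}) : (i <= k)%N -> [set` F] `<=` B ->
    (#|` F| = k - i)%N%fset ->
    K (iter ((\sum_(n <- F) n) + t) T (iter i p a)).
  have := key k fset0 (leqnn k); rewrite big_seq_fset0 subnn; apply => //.
elim: i F => [|i IH] F ik FB cF.
  by apply: HB; exists F => //; split=> //; rewrite cF subn0.
set y := iter i p a in IH *; rewrite iterS -/y.
set s := (\sum_(n <- F) n)%N.
(* The outermost [p] is the one expanded: what stands in front of it is an iterate of [T], which is
   continuous, whereas [p] itself need not be. *)
have : iter (s + t) T (iter n T y) @[n --> U] --> iter (s + t) T (p y).
  exact: (continuous_cvg _ (cTn _ _) (pE y)).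
apply: (closed_cvg K cK).
near=> n.
have Bn : B n by near: n.
(* Every element of [F] is at most the sum [s], so [n] is new. *)
have sn : (s < n)%N by near: n; exact: Uge.
have nF : n \notin F.
  apply/negP => nF; move: sn; rewrite ltnNge => /negP; apply.
  by rewrite /s (big_fsetD1 n)//= leq_addr.
have := IH (n |` F)%fset (ltnW ik).
rewrite big_fsetU1//= -iterD [(s + t + n)%N]addnC addnA; apply.
  by move=> m /=; rewrite !inE => /orP[/eqP->//|/FB].
by rewrite cardfsU1 nF cF add1n subnSK.
Unshelve. all: by end_near.
Qed.

(** * The two-sided shift on bi-infinite binary sequences *)

(* [R] is a phantom parameter: it fixes the field of values of the metric. *)
Definition biseq (R : realType) : Type := int -> bool.

HB.instance Definition _ (R : realType) := gen_eqMixin (biseq R).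
HB.instance Definition _ (R : realType) := gen_choiceMixin (biseq R).
HB.instance Definition _ (R : realType) :=
  isPointed.Build (biseq R) (fun=> false).

Section biseq_metric.
Context {R : realType}.
Implicit Types (x y z : biseq R) (m : nat).

Definition agree m x y := forall i : int, (`|i| < m)%N -> x i = y i.

Lemma agree_sym m x y : agree m x y -> agree m y x.
Proof. by move=> xy i im; rewrite xy. Qed.

Lemma agree_trans m y x z : agree m x y -> agree m y z -> agree m x z.
Proof. by move=> xy yz i im; rewrite xy// yz. Qed.

Lemma agreeW m n x y : (m <= n)%N -> agree n x y -> agree m x y.
Proof. by move=> mn xy i im; apply: xy; exact: leq_trans mn. Qed.

(** The standard ultrametric: [1 / (m + 1)] for the largest radius [m] of agreement, and 0 for equal
    sequences. *)
Definition biseq_dist x y : R := inf [set (m.+1%:R^-1 : R) | m in [set m | agree m x y]].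

Let lb0 x y : lbound [set (m.+1%:R^-1 : R) | m in [set m | agree m x y]] 0.
Proof. by move=> _ [m _ <-]. Qed.

Let nonempty x y : [set (m.+1%:R^-1 : R) | m in [set m | agree m x y]] !=set0.
Proof. by exists 1; exists 0%N; [move=> i|rewrite invr1]. Qed.

Lemma biseq_dist_le m x y : agree m x y -> biseq_dist x y <= m.+1%:R^-1.
Proof. by move=> xy; apply: ge_inf; [exists 0; exact: lb0|exists m]. Qed.

Lemma biseq_dist_lt x y (e : R) : biseq_dist x y < e ->
  exists2 m, m.+1%:R^-1 < e & agree m x y.
Proof.
move=> /(inf_lt (nonempty x y))[_ [m xy <-] me].
by exists m.
Qed.

Lemma biseq_dist_ge0 x y : 0 <= biseq_dist x y.
Proof. by apply: lb_le_inf; [exact: nonempty|exact: lb0]. Qed.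

Lemma biseq_dist_agree m x y : biseq_dist x y < m.+1%:R^-1 -> agree m x y.
Proof.
move=> /biseq_dist_lt[n nm]; apply: agreeW; rewrite leqNgt; apply/negP => nm'.
move: nm; rewrite ltf_pV2 ?posrE// ltr_nat ltnS => mn.
by move: nm'; rewrite ltnNge (ltnW mn).
Qed.

Lemma biseq_distxx x : biseq_dist x x = 0.
Proof.
apply/eqP; rewrite eq_le biseq_dist_ge0 andbT leNgt; apply/negP => d0.
have [m md] : exists m : nat, m.+1%:R^-1 < biseq_dist x x.
  have := near_infty_natSinv_lt (PosNum d0).
  by move=> [m _ /(_ m (leqnn m))] /= h; exists m.
have := @biseq_dist_le m x x (fun _ _ => erefl).
by rewrite leNgt md.
Qed.

Lemma biseq_dist_eq0 x y : biseq_dist x y = 0 -> x = y.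
Proof.
move=> xy0; apply/funext => i.
by apply: (@biseq_dist_agree `|i|.+1); rewrite ?xy0// invr_gt0.
Qed.

Lemma biseq_dist_sym x y : biseq_dist x y = biseq_dist y x.
Proof.
rewrite /biseq_dist; congr inf; apply/seteqP.
by split => _ [m xy <-]; exists m => //; exact: agree_sym.
Qed.

Lemma biseq_dist_triangle y x z : biseq_dist x z <= biseq_dist x y + biseq_dist y z.
Proof.
apply/ler_addgt0Pl => e e0.
have [|m me xy] := @biseq_dist_lt x y (biseq_dist x y + e / 2); first lra.
have [|n ne yz] := @biseq_dist_lt y z (biseq_dist y z + e / 2); first lra.
have m0 : 0 < m.+1%:R^-1 :> R by [].
have n0 : 0 < n.+1%:R^-1 :> R by [].
have [mn|/ltnW mn] := leqP m n.
  have := biseq_dist_le (agree_trans xy (agreeW mn yz)).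
  by move: me m0 ne n0; move: m.+1%:R^-1 n.+1%:R^-1 => u v; lra.
have := biseq_dist_le (agree_trans (agreeW mn xy) yz).
by move: me m0 ne n0; move: m.+1%:R^-1 n.+1%:R^-1 => u v; lra.
Qed.

HB.instance Definition _ := isMetric.Build R (biseq R)
  biseq_distxx biseq_dist_eq0 biseq_dist_sym biseq_dist_triangle.

Lemma nbhs_agree x (A : set (biseq R)) :
  nbhs x A <-> exists m, [set y | agree m x y] `<=` A.
Proof.
split.
  move=> /nbhs_ballP[e /= e0 eA].
  have [m _ /(_ m (leqnn m)) /= me] := near_infty_natSinv_lt (PosNum e0).
  exists m => y xy; apply: eA; rewrite ballEmdist /=.
  exact: le_lt_trans (biseq_dist_le xy) me.
move=> [m mA]; apply/nbhs_ballP; exists m.+1%:R^-1; first by rewrite /= invr_gt0.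
by move=> y; rewrite ballEmdist /= => /biseq_dist_agree /mA.
Qed.

(** An ultrafilter decides each coordinate. The sequence of decisions is its limit, since a basic
    neighbourhood constrains finitely many coordinates. *)
Lemma biseq_compact : compact [set: biseq R].
Proof.
rewrite compact_ultra => F FU _.
pose x : biseq R := fun i => `[< F [set y | y i] >].
exists x; split => // A /nbhs_agree[m mA]; apply: filterS mA _.
have Fi (i : int) : F [set y | x i = y i].
  rewrite /x; case: asboolP => [|nF]; first by apply: filterS => y /= ->.
  have [//|] := in_ultra_setVsetC [set y : biseq R | y i] FU.
  by apply: filterS => y /= /negP/negbTE ->.
have : F [set y | forall j : 'I_m, x j%:Z = y j%:Z /\ x (- j%:Z) = y (- j%:Z)].
  by apply: filter_forall => j; apply: filterI; exact: Fi.
apply: filterS => y xy i im.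
have [+ +] := xy (Ordinal im) => /=.
by case: i {im} => n //=; rewrite NegzE => ? ->.
Qed.

Definition bshift x : biseq R := fun i => x (i + 1).
Definition bunshift x : biseq R := fun i => x (i - 1).

Lemma bshift_agree m x y : agree m.+1 x y -> agree m (bshift x) (bshift y).
Proof. by move=> xy i im; apply: xy; lia. Qed.

Lemma bunshift_agree m x y : agree m.+1 x y -> agree m (bunshift x) (bunshift y).
Proof. by move=> xy i im; apply: xy; lia. Qed.

Lemma bshift_homeo : is_homeomorphism bshift.
Proof.
split.
  move=> x A /nbhs_agree[m mA]; apply/nbhs_agree; exists m.+1 => y xy.
  exact/mA/bshift_agree.
exists bunshift; split.
- by move=> x; apply/funext => i; rewrite /bunshift /bshift subrK.
- by move=> x; apply/funext => i; rewrite /bunshift /bshift addrK.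
- move=> x A /nbhs_agree[m mA]; apply/nbhs_agree; exists m.+1 => y xy.
  exact/mA/bunshift_agree.
Qed.

Lemma iter_bshift n x i : iter n bshift x i = x (i + n%:Z).
Proof.
elim: n x i => [|n IH] x i /=; first by rewrite addr0.
by rewrite /bshift IH; congr (x _); lia.
Qed.

(** * Cylinder sets and their finite codes *)

Definition cylinder m (C : set (biseq R)) :=
  forall x y, agree m x y -> C x -> C y.

Definition is_cylinder (C : set (biseq R)) := exists m, cylinder m C.

Lemma cylinderW m n C : (m <= n)%N -> cylinder m C -> cylinder n C.
Proof. by move=> mn Cm x y /(agreeW mn); exact: Cm. Qed.

Lemma cylinder0 m : cylinder m set0. Proof. by []. Qed.

Lemma cylinderC m C : cylinder m C -> cylinder m (~` C).
Proof. by move=> Cm x y xy nCx Cy; apply/nCx/(Cm _ _ (agree_sym xy)). Qed.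

Lemma cylinderU m C D : cylinder m C -> cylinder m D -> cylinder m (C `|` D).
Proof. by move=> Cm Dm x y xy [/(Cm _ _ xy)|/(Dm _ _ xy)]; [left|right]. Qed.

Lemma is_cylinder0 : is_cylinder set0.
Proof. by exists 0%N; exact: cylinder0. Qed.

Lemma is_cylinderC C : is_cylinder C -> is_cylinder (~` C).
Proof. by move=> [m /cylinderC]; exists m. Qed.

Lemma is_cylinderU C D : is_cylinder C -> is_cylinder D -> is_cylinder (C `|` D).
Proof.
move=> [m Cm] [n Dn]; exists (maxn m n).
apply: cylinderU; first exact: cylinderW (leq_maxl m n) Cm.
exact: cylinderW (leq_maxr m n) Dn.
Qed.

Lemma cylinder_open C : is_cylinder C -> open C.
Proof.
move=> [m Cm]; rewrite openE => x Cx; apply/nbhs_agree; exists m => y xy.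
exact: Cm Cx.
Qed.

Lemma cylinder_preimage m C : cylinder m C -> cylinder m.+1 (bshift @^-1` C).
Proof. by move=> Cm x y xy; apply: Cm; exact: bshift_agree. Qed.

Definition atom m x : set (biseq R) := [set y | agree m x y].

(** The boolean is the sign of the index, so coordinate 0 is recorded twice. A word with two
    different entries there is the code of no sequence, and [bidecode] then returns its default. *)
Definition bicode m x : {ffun 'I_m * bool -> bool} :=
  [ffun p : 'I_m * bool => x (if p.2 then (p.1 : nat)%:Z else - (p.1 : nat)%:Z)].

Definition bidecode m (w : {ffun 'I_m * bool -> bool}) : biseq R :=
  xget (fun=> false) [set x | bicode m x = w].

Lemma bicode_agree m x y : bicode m x = bicode m y <-> agree m x y.
Proof.
split.
  move=> /ffunP h i im; have := h (Ordinal im, 0 <= i); rewrite !ffunE /=.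
  by case: (lerP 0 i) => i0; rewrite (_ : `|i|%N%:Z = `|i|)
    ?(ger0_norm i0) ?(ltr0_norm i0) ?opprK//; lia.
move=> xy; apply/ffunP => -[j b]; rewrite !ffunE /=; apply: xy.
by case: b; have := ltn_ord j; lia.
Qed.

Lemma agree_bidecode m x : agree m x (bidecode (bicode m x)).
Proof.
apply/bicode_agree; rewrite /bidecode.
suff /(xgetPex (fun=> false)) -> :
  exists y, [set y | bicode m y = bicode m x] y by [].
by exists x.
Qed.

(** A cylinder of level [m] is determined by the set of codes of its points, and there are finitely
    many sets of codes. *)
Lemma finite_cylinders m : finite_set [set C | cylinder m C].
Proof.
pose f (G : {set {ffun 'I_m * bool -> bool}}) : set (biseq R) := [set x | bicode m x \in G].
apply: (@sub_finite_set _ _ (f @` setT)); last exact/finite_image/finite_finset.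
move=> C Cm; exists [set w : {ffun 'I_m * bool -> bool} | `[< C (bidecode w) >]]%SET => //.
apply/seteqP; split => x; rewrite /f /= inE.
  by move=> /asboolP; apply: Cm; apply: agree_sym; exact: agree_bidecode.
by move=> Cx; apply/asboolP; apply: Cm Cx; exact: agree_bidecode.
Qed.

End biseq_metric.

(** * Borel probabilities from additive functions on cylinders *)

(* An alias of [biseq R] whose measurable sets are the cylinders only. *)
Definition cylspace (R : realType) : Type := biseq R.

HB.instance Definition _ (R : realType) := Pointed.on (cylspace R).
HB.instance Definition _ (R : realType) :=
  isAlgebraOfSets.Build default_measure_display (cylspace R)
    (@is_cylinder0 R) (@is_cylinderU R) (@is_cylinderC R).

Lemma borel_biseqE (R : realType) :
  <<s @open (biseq R) >> = <<s @is_cylinder R >>.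
Proof.
apply/seteqP; split; apply: smallest_sub => //.
- move=> O oO.
  (* [[set x | atom m x `<=` O]] is itself a cylinder of level [m]. *)
  have -> : O = \bigcup_m [set x | atom m x `<=` O].
    apply/seteqP; split => x /=.
      rewrite openE in oO => /oO /nbhs_agree [m mO]; exists m => //.
    by move=> [m _ /= xO]; apply: xO => i.
  have [_ _] := smallest_sigma_algebra [set: biseq R] (@is_cylinder R).
  apply => m; apply: sub_sigma_algebra; exists m => x y xy /= xO z yz.
  by apply: xO; exact: agree_trans yz.
- by move=> C cC; apply: sub_sigma_algebra; exact: cylinder_open.
Qed.

Section probability_of_measure.
Context d (T : measurableType d) (R : realType).
Context (m : {measure set T -> \bar R}) (mT : m setT = 1%E).

(** An alias that carries the normalization proof, so that the probability structure can be attached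
    to it. *)
Definition probability_of_measure of m setT = 1%E : set T -> \bar R := m.

HB.instance Definition _ := Measure.on (probability_of_measure mT).
HB.instance Definition _ :=
  Measure_isProbability.Build _ _ _ (probability_of_measure mT) mT.

End probability_of_measure.

Section cylinder_measure.
Context {R : realType} (L : set (biseq R) -> R).
Hypothesis L_ge0 : forall C, 0 <= L C.
Hypothesis LT : L setT = 1.
Hypothesis LU : forall C D, is_cylinder C -> is_cylinder D ->
  C `&` D = set0 -> L (C `|` D) = L C + L D.
Hypothesis Lshift : forall C, is_cylinder C -> L (bshift @^-1` C) = L C.

Let L0 : L set0 = 0.
Proof.
have := LU is_cylinder0 is_cylinder0 (setI0 _); rewrite setU0 => /eqP.
by rewrite -subr_eq subrr => /eqP.
Qed.

Lemma cylinder_sigma_additive :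
  semi_sigma_additive ((fun C => (L C)%:E) : set (cylspace R) -> \bar R).
Proof.
move=> F mF tF mUF.
(* By compactness only finitely many of the disjoint cylinders [F i] are nonempty. *)
have cUF : compact (\bigcup_i F i : set (biseq R)).
  apply: (subclosed_compact _ biseq_compact) => //.
  by rewrite -[X in closed X]setCK; apply/open_closedC/cylinder_open/is_cylinderC.
rewrite compact_cover in cUF.
have [|D _ UD] := cUF nat setT F _ (@subset_refl _ _).
  by move=> i _; apply: cylinder_open; exact: mF.
have sumL n : \sum_(0 <= i < n) (L (F i))%:E = (L (\big[setU/set0]_(i < n) F i))%:E.
  elim: n => [|n IH]; first by rewrite big_nil big_ord0 L0.
  rewrite big_nat_recr//= IH big_ord_recr /= LU//.
    exact: (@bigsetU_measurable _ (cylspace R)).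
    exact: mF.
  rewrite -bigcup_mkord -subset0 => x [[m /= mn Fmx] Fnx].
  have mn' : m = n by apply: tF => //; exists x.
  by rewrite mn' ltnn in mn.
(* This sum exceeds every index in [D], so from there on the partial unions equal the whole
   union. *)
apply: cvg_near_cst; exists (\sum_(i <- D) i.+1)%N => // n /= Dn.
rewrite sumL; congr (L _)%:E; apply/seteqP; split.
  by rewrite -bigcup_mkord => x [i _ Fix]; exists i.
move=> x /UD [i /= iD Fix]; rewrite -bigcup_mkord; exists i => //=.
apply: leq_trans Dn; rewrite (big_fsetD1 i)//=; exact: leq_addr.
Qed.

(** Caratheodory extension from the algebra of cylinders, read on the Borel sets. Invariance follows
    from uniqueness: the measure and its push-forward by the shift agree on cylinders, which are
    stable under intersection and generate. *)
Lemma cylinder_measure_extension :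
  exists mu : probability (borel (biseq R)) R,
    (forall C, is_cylinder C -> mu C = (L C)%:E) /\
    (forall A : set (borel (biseq R)), measurable A -> mu (bshift @^-1` A) = mu A).
Proof.
pose L' := (fun C => (L C)%:E) : set (cylspace R) -> \bar R.
have L'0 : L' set0 = 0%E by rewrite /L' L0.
have L'ge0 C : (0 <= L' C)%E by rewrite lee_fin.
pose l : {measure set (cylspace R) -> \bar R} :=
  HB.pack L' (isMeasure.Build _ (cylspace R) R L' L'0 L'ge0 cylinder_sigma_additive).
pose nu := measure_extension l.
have sub (A : set (biseq R)) : <<s @open (biseq R) >> A -> <<s @is_cylinder R >> A.
  by rewrite borel_biseqE.
pose nu' := nu : set (borel (biseq R)) -> \bar R.
have nu'0 : nu' set0 = 0%E by exact: (measure0 nu).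
have nu'ge0 C : (0 <= nu' C)%E by exact: (measure_ge0 nu).
have nu'add : semi_sigma_additive nu'.
  move=> F mF tF mUF.
  exact: (@measure_semi_sigma_additive _ _ _ nu F (fun i => sub _ (mF i)) tF (sub _ mUF)).
have nuE C : is_cylinder C -> nu' C = (L C)%:E.
  move=> cC; exact: (@measurable_mu_extE _ _ _ l).
pose m : {measure set (borel (biseq R)) -> \bar R} :=
  HB.pack nu' (isMeasure.Build _ (borel (biseq R)) R nu' nu'0 nu'ge0 nu'add).
have cT : is_cylinder [set: biseq R] by exists 0%N.
have mT : m setT = 1%E by rewrite /= nuE// LT.
pose P : probability (borel (biseq R)) R :=
  probability_of_measure mT.
exists P; split; first exact: nuE.
have mshift (A : set (borel (biseq R))) :
  measurable A -> measurable (bshift @^-1` A : set (borel (biseq R))).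
  move=> mA; rewrite -[X in measurable X]setTI.
  have mf : measurable_fun [set: borel (biseq R)] (bshift : borel _ -> borel (biseq R)).
    apply: (@measurability _ _ (borel (biseq R)) (borel (biseq R)) setT bshift
      (@open (biseq R)) erefl).
    move=> _ [V oV <-]; rewrite setTI; apply: sub_sigma_algebra.
    by apply: open_comp => // x _; exact: bshift_homeo.1.
  exact: mf.
pose s := (fun A => m (bshift @^-1` A)) : set (borel (biseq R)) -> \bar R.
have s0 : s set0 = 0%E by rewrite /s preimage_set0 measure0.
have sge0 C : (0 <= s C)%E by exact: measure_ge0.
have sadd : semi_sigma_additive s.
  move=> F mF tF mUF; rewrite /s preimage_bigcup.
  apply: measure_semi_sigma_additive.
  - by move=> i; exact: mshift.
  - by move=> i j _ _ [x [Fi Fj]]; apply: tF => //; exists (bshift x).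
  - by rewrite -preimage_bigcup; exact: mshift.
pose ms : {measure set (borel (biseq R)) -> \bar R} :=
  HB.pack s (isMeasure.Build _ (borel (biseq R)) R s s0 sge0 sadd).
move=> A mA.
apply: (@measure_unique _ R (borel (biseq R)) (@is_cylinder R) (fun=> setT)
  _ _ _ _ ms m _ _ A mA) => //.
- exact: borel_biseqE.
- exact: (@measurableI _ (cylspace R)).
- by rewrite bigcup_const.
- move=> C cC; have [k Ck] := cC.
  have cC' : is_cylinder (bshift @^-1` C) by exists k.+1; exact: cylinder_preimage.
  by rewrite /= /s /= !nuE// Lshift.
- by move=> _; rewrite /= /s preimage_setT mT ltry.
Qed.

End cylinder_measure.

(** * Weak-star convergence tested on cylinders *)

Lemma biseq_unif_continuous (R : realType) (f : biseq R -> R) (e : R) :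
  continuous f -> 0 < e ->
  exists m, forall x y, agree m x y -> `|f x - f y| < e.
Proof.
move=> cf e0; apply: contrapT => /forallNP H.
have /choice[xy xyP] : forall m, exists xy : biseq R * biseq R,
    agree m xy.1 xy.2 /\ e <= `|f xy.1 - f xy.2|.
  move=> m; have /existsNP[x /existsNP[y /not_implyP[xy /negP]]] := H m.
  by rewrite -leNgt; exists (x, y).
pose u m := (xy m).1.
have [z [_ cz]] := biseq_compact (fmap_proper_filter u eventually_filter) filterT.
have e2 : 0 < e / 2 by lra.
have /nbhs_agree[k kP] : \forall y \near z, `|f z - f y| < e / 2.
  by have /cvgrPdist_lt/(_ _ e2) := cf z.
have uk : (u @ \oo) [set u m | m in [set m | (k <= m)%N]].
  by exists k => // m km; exists m.
have [|x [[m /= km <-] zx]] := cz _ (atom k z) uk; first by apply/nbhs_agree; exists k.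
have [xym] := xyP m; apply/negP; rewrite -ltNge.
have h1 : `|f z - f (xy m).1| < e / 2 by exact: kP.
have h2 : `|f z - f (xy m).2| < e / 2.
  by apply: kP; exact: agree_trans zx (agreeW km xym).
by rewrite (le_lt_trans (ler_distD (f z) _ _))// distrC; lra.
Qed.

Lemma generic_cylinders (R : realType) (mu : probability (borel (biseq R)) R)
    (a : biseq R) (Phi : nat -> {fset nat}) :
  (forall N, Phi N != fset0) ->
  (forall C, is_cylinder C ->
    (fun N => avg (Phi N) (fun n => \1_C (iter n bshift a) : R)) @ \oo --> fine (mu C)) ->
  generic mu bshift Phi a.
Proof.
move=> Phi0 HC f cf.
have mf := continuous_borel_measurable cf.
have -> : (fun N => Rintegral (empirical_measure bshift a (Phi N)) setT f) =
    (fun N => avg (Phi N) (fun n => f (iter n bshift a))).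
  by apply/funext => N; exact: Rintegral_empirical.
(* [P] is linear and holds for indicators of cylinders, hence for [g] below. *)
pose P (h : borel (biseq R) -> R) := mu.-integrable setT (EFin \o h) /\
  (fun N => avg (Phi N) (fun n => h (iter n bshift a))) @ \oo --> Rintegral mu setT h.
have PD h1 h2 : P h1 -> P h2 -> P (fun x => h1 x + h2 x).
  move=> [i1 c1] [i2 c2]; split; first exact: (integrableD measurableT i1 i2).
  rewrite RintegralD//; under eq_fun do rewrite avgD.
  exact: cvgD.
have PZ c h : P h -> P (fun x => c * h x).
  move=> [i1 c1]; split; first exact: (integrableZl measurableT c i1).
  rewrite RintegralZl//; under eq_fun do rewrite avgZ.
  exact: cvgMr.
have P1 C : is_cylinder C -> P \1_C.
  move=> cC.
  have mC : measurable (C : set (borel (biseq R))).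
    by apply: sub_sigma_algebra; exact: cylinder_open.
  split; last by rewrite /Rintegral integral_indic// setIT; exact: HC.
  apply: (@probability_bounded_integrable _ _ _ _ _ 1) => [|x].
    exact: measurable_indic.
  by rewrite ger0_norm// indicE lern1 leq_b1.
apply/cvgrPdist_lt => e e0.
have e3 : 0 < e / 4 by lra.
have [m mP] := biseq_unif_continuous cf e3.
pose G := {ffun 'I_m * bool -> bool}.
pose at_ (w : G) : set (biseq R) := [set y | bicode m y = w].
(* [g] replaces [f x] by the value of [f] at a representative of the level-[m] atom of [x]. *)
pose g (x : biseq R) : R := \sum_(w : G) f (bidecode w) * \1_(at_ w) x.
have gE x : g x = f (bidecode (bicode m x)).
  rewrite /g (bigD1 (bicode m x))//= big1 ?addr0 => [|w /eqP xw].
    by rewrite indicE mem_set// mulr1.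
  by rewrite indicE memNset ?mulr0// => /= xw'; apply: xw.
have fg x : `|f x - g x| <= e / 4 by rewrite gE ltW// mP//; exact: agree_bidecode.
have [ig cg] : P g.
  rewrite (_ : g = fun x => \sum_(w : G) f (bidecode w) * \1_(at_ w) x)//.
  elim: (index_enum G) => [|w s IH].
    under [X in P X]eq_fun do rewrite big_nil.
    have := PZ 0 _ (P1 _ (@is_cylinder0 R)).
    by under [X in P X -> _]eq_fun do rewrite mul0r.
  under [X in P X]eq_fun do rewrite big_cons.
  apply: PD => //; apply: PZ; apply: P1; exists m => x y xy /= <-.
  by apply/bicode_agree; exact: agree_sym.
pose M := \sum_(w : G) `|f (bidecode w)| + e / 4.
have fM x : `|f x| <= M.
  have -> : f x = (f x - g x) + g x by rewrite subrK.
  rewrite (le_trans (ler_normD _ _))// addrC lerD// gE.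
  by rewrite (bigD1 (bicode m x))//= lerDl sumr_ge0.
have if_ : mu.-integrable setT (EFin \o f).
  exact: (@probability_bounded_integrable _ _ _ _ _ M).
have ifg : mu.-integrable setT (EFin \o (fun x => f x - g x)).
  exact: (integrableB measurableT if_ ig).
have Ifg : `|Rintegral mu setT f - Rintegral mu setT g| <= e / 4.
  rewrite -RintegralB//; apply: le_trans (le_normr_Rintegral _ _) _ => //.
  have -> : e / 4 = Rintegral mu setT (fun=> e / 4).
    rewrite Rintegral_cst// -[LHS]mulr1; congr (_ * _).
    by rewrite -[LHS]/(fine 1%E); congr fine; exact/esym/(probability_setT mu).
  apply: le_Rintegral => //.
    exact: (integrable_norm ifg).
  apply: (@probability_bounded_integrable _ _ _ _ _ `|e / 4|) => //.
have e4 : 0 < e / 4 by lra.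
(* Three errors of at most [e / 4] each: between the integrals, between the averages, and in the
   convergence for [g]. *)
move/cvgrPdist_lt: cg => /(_ _ e4); apply: filterS => N.
set If := Rintegral mu setT f in Ifg *; set Ig := Rintegral mu setT g in Ifg *.
have h1 : avg (Phi N) (fun n => f (iter n bshift a)) <=
    avg (Phi N) (fun n => g (iter n bshift a)) + e / 4.
  rewrite -[e / 4](avg_cst _ (Phi0 N)) -avgD; apply: le_avg => n.
  by have := fg (iter n bshift a); rewrite ler_norml; lra.
have h2 : avg (Phi N) (fun n => g (iter n bshift a)) <=
    avg (Phi N) (fun n => f (iter n bshift a)) + e / 4.
  rewrite -[e / 4](avg_cst _ (Phi0 N)) -avgD; apply: le_avg => n.
  by have := fg (iter n bshift a); rewrite ler_norml; lra.
move: Ifg; rewrite ler_norml !ltr_norml; lra.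
Qed.

(** * The correspondence principle *)

Definition interval_fset (M N : nat) : {fset nat} := [fset n in iota M.+1 N]%fset.

Lemma mem_interval_fset M N n : (n \in interval_fset M N) = (M < n <= M + N)%N.
Proof. by rewrite !inE /= mem_iota addSn ltnS. Qed.

Lemma card_interval_fset M N : #|` interval_fset M N|%fset = N.
Proof. by rewrite card_fseq undup_id ?iota_uniq// size_iota. Qed.

Lemma interval_fset_neq0 M N : (0 < N)%N -> interval_fset M N != fset0.
Proof. by rewrite -cardfs_gt0 card_interval_fset. Qed.

Lemma avg_interval (R : realType) M N (g : nat -> R) :
  avg (interval_fset M N) g = N%:R^-1 * \sum_(h < N) g (M + h.+1)%N.
Proof.
rewrite /avg card_interval_fset; congr (_ * _).
have -> : \sum_(n <- interval_fset M N) g n = \sum_(n <- iota M.+1 N) g n.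
  apply: perm_big; apply: uniq_perm; rewrite ?iota_uniq ?fset_uniq// => n.
  by rewrite !inE.
rewrite -[M.+1]addn0 iotaDl big_map (_ : iota 0 N = index_iota 0 N).
  by rewrite big_mkord; apply: eq_bigr => h _; rewrite addSnnS.
by rewrite /index_iota subn0.
Qed.

(** The difference telescopes to two boundary terms in [[0, 1]]. *)
Lemma avg_interval_shift (R : realType) M N (g : nat -> R) :
  (0 < N)%N -> (forall n, 0 <= g n <= 1) ->
  `|avg (interval_fset M N) (fun n => g n.+1) - avg (interval_fset M N) g| <= N%:R^-1.
Proof.
move=> N0 g01; rewrite !avg_interval -mulrBr -sumrB normrM ger0_norm//.
rewrite ler_piMr//.
have -> : \sum_(i < N) (g (M + i.+1).+1 - g (M + i.+1)%N) = g (M + N).+1 - g M.+1.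
  elim: N {N0} => [|N IH]; first by rewrite big_ord0 addn0 subrr.
  by rewrite big_ord_recr /= IH !addnS; lra.
have := g01 (M + N).+1; have := g01 M.+1; rewrite ler_norml; lra.
Qed.

(** A shift by [h] loses at most [h] points of the interval, and [h / N n] tends to 0. *)
Lemma interval_folner (R : realType) (M N : nat -> nat) :
  (forall n, (n < N n)%N) -> is_folner R (fun n => interval_fset (M n) (N n)).
Proof.
move=> nN; split.
  move=> n; split; last by apply: interval_fset_neq0; exact: leq_ltn_trans (nN n).
  by move=> m /=; rewrite mem_interval_fset /posN /=; lia.
move=> h h0; apply/cvgrPdist_le => e e0.
near=> n.
rewrite card_interval_fset.
set S := fset_set _.
have N0 : 0 < (N n)%:R :> R by rewrite ltr0n; exact: leq_ltn_trans (nN n).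
have S1 : (#|` S| <= N n)%N%fset.
  rewrite -[X in (_ <= X)%N](card_interval_fset (M n)); apply: fsubset_leq_card.
  apply/fsubsetP => m; rewrite in_fset_set; last first.
    by apply: finite_setIr; exact: finite_fset.
  by rewrite inE => -[].
have S2 : (N n - h <= #|` S|)%N%fset.
  rewrite -[X in (X <= _)%N](card_interval_fset (M n)); apply: fsubset_leq_card.
  apply/fsubsetP => m; rewrite in_fset_set; last first.
    by apply: finite_setIr; exact: finite_fset.
  rewrite mem_interval_fset inE /= /shiftN /posN /= !mem_interval_fset => mM.
  by split; [split; lia|lia].
have q1 : (#|` S|%fset)%:R / (N n)%:R <= 1 :> R.
  by rewrite ler_pdivrMr// mul1r ler_nat.
rewrite ger0_norm ?subr_ge0// lerBlDl -lerBlDr ler_pdivlMr// mulrBl mul1r.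
have : (N n)%:R <= (#|` S|%fset)%:R + h%:R :> R by rewrite -natrD ler_nat; lia.
suff : h%:R <= e * (N n)%:R by lra.
rewrite mulrC -ler_pdivrMr//.
have : h%:R / e <= n%:R by near: n; exact: nbhs_infty_ger.
by move=> /le_trans; apply; rewrite ler_nat ltnW.
Unshelve. all: by end_near. Qed.

Lemma upper_banach_density_gt0P (R : realType) (A : set nat) :
  (0 < upper_banach_density R A)%E ->
  exists2 c : R, 0 < c & forall n, exists M N, (n < N)%N /\
    c <= avg (interval_fset M N) (fun m => (m \in A)%:R).
Proof.
move=> d0.
(* The density is an extended real; an infinite value is given the constant 1. *)
have [c c0 cd] : exists2 c : R, 0 < c & (c%:E < upper_banach_density R A)%E.
  move: d0; case: (upper_banach_density R A) => [r| |]//.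
  - by rewrite lte_fin => r0; exists (r / 2); rewrite ?lte_fin; lra.
  - by exists 1; rewrite ?ltry.
exists c => // n.
have : (c%:E < ereal_sup [set ereal_sup (range (fun M =>
    ((#|` fset_set (window A M N)|%fset)%:R / N%:R : R)%:E)) |
    N in [set N | (n < N)%N]])%E.
  apply: lt_le_trans cd _; apply: ereal_inf_lbound.
  by exists [set N | (n < N)%N] => //; exists n.+1.
move=> /ereal_sup_gt[_ [N /= nN <-] /ereal_sup_gt[_ [M _ <-]]].
rewrite lte_fin => /ltW cM; exists M, N; split=> //.
rewrite (le_trans cM)// avg_interval card_window natr_sum mulrC.
by [].
Qed.

Lemma ultra_cvg_bounded (R : realType) (U : set_system nat) (g : nat -> R) :
  UltraFilter U -> (forall n, 0 <= g n <= 1) -> exists l : R, g n @[n --> U] --> l.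
Proof.
move=> UU g01.
have U01 : (g n @[n --> U]) `[0, 1]%classic.
  by apply: (@filterE _ U) => n /=; rewrite in_itv /= g01.
have [l [_ cl]] := @segment_compact R 0 1 _ (fmap_proper_filter g ultra_proper) U01.
exists l => V Vl; have [//|UV] := in_ultra_setVsetC (g @^-1` V) UU.
by have [z [nVz Vz]] := cl (~` V) V UV Vl.
Qed.

Lemma correspondence (R : realType) (A : set nat) :
  (0 < upper_banach_density R A)%E ->
  exists (a : biseq R) (Phi : nat -> {fset nat})
    (mu : probability (borel (biseq R)) R),
  [/\ forall n, (0 < n)%N -> a n%:Z -> A n, is_folner R Phi,
      is_system mu bshift, generic mu bshift Phi a &
      (0 < mu [set x : biseq R | x 0%R])%E].
Proof.
move=> /upper_banach_density_gt0P[c c0 cP].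
have /choice[MN MNP] : forall n, exists p : nat * nat, (n < p.2)%N /\
    c <= avg (interval_fset p.1 p.2) (fun m => (m \in A)%:R).
  by move=> n; have [M [N ?]] := cP n; exists (M, N).
(* The indicator of [A] is reflected to negative indices; visits of the forward orbit to the
   coordinate-zero set read nonnegative indices only. *)
pose a : biseq R := fun i => `|i|%N \in A.
pose F n := interval_fset (MN n).1 (MN n).2.
have F0 n : F n != fset0.
  by apply: interval_fset_neq0; exact: leq_ltn_trans (MNP n).1.
pose freq (C : set (biseq R)) n : R := avg (F n) (fun m => \1_C (iter m bshift a)).
have freq01 C n : 0 <= freq C n <= 1.
  apply/andP; split.
    by rewrite -[leLHS](avg_cst 0 (F0 n)); apply: le_avg => m.
  by rewrite -[leRHS](avg_cst 1 (F0 n)); apply: le_avg => m; rewrite indicE lern1 leq_b1.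
(* One ultrafilter gives limits of the frequencies of all sets simultaneously, so additivity passes
   to the limit. *)
have [U [UU oU]] := ultraFilterLemma (@eventually_filter).
have /choice[L LP] : forall C, exists l : R, freq C n @[n --> U] --> l.
  by move=> C; exact: ultra_cvg_bounded.
have Luniq C l : freq C n @[n --> U] --> l -> L C = l.
  by move=> Cl; apply: (cvg_unique _ (LP C) Cl); exact: Rhausdorff.
have L_ge0 C : 0 <= L C.
  apply: (cvgr_to_ge (LP C)).
  by apply: (@filterE _ U) => n /=; have /andP[] := freq01 C n.
have LT : L setT = 1.
  apply: Luniq; rewrite (_ : freq _ = fun=> 1); first exact: cvg_cst.
  by apply/funext => n; rewrite /freq indicT; exact: avg_cst.
have LU C D : is_cylinder C -> is_cylinder D ->
    C `&` D = set0 -> L (C `|` D) = L C + L D.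
  move=> _ _ CD; apply: Luniq.
  rewrite (_ : freq _ = fun n => freq C n + freq D n); first exact: cvgD.
  apply/funext => n; rewrite /freq -avgD; congr avg; apply/funext => m.
  have nCD (x : biseq R) : C x -> D x -> False.
    by move=> Cx Dx; rewrite -[False]/(set0 x) -CD.
  rewrite !indicE in_setU; case: (boolP (_ \in C)) => [/set_mem Cx|_]; last by rewrite add0r.
  by rewrite memNset ?addr0// => /(nCD _ Cx).
have Lshift C : is_cylinder C -> L (bshift @^-1` C) = L C.
  move=> _; apply: Luniq.
  rewrite (_ : freq _ = fun n => freq C n + (freq (bshift @^-1` C) n - freq C n)); last first.
    by apply/funext => n; rewrite addrC subrK.
  rewrite -[X in _ --> X]addr0; apply: cvgD => //.
  have : (freq (bshift @^-1` C) n - freq C n) @[n --> \oo] --> (0 : R).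
    apply/cvgrPdist_lt => e e0; near=> n; rewrite sub0r normrN.
    have N0 : (0 < (MN n).2)%N by exact: leq_ltn_trans (MNP n).1.
    apply: (@le_lt_trans _ _ n.+1%:R^-1); last first.
      by near: n; exact: (near_infty_natSinv_lt (PosNum e0)).
    apply: (@le_trans _ _ (MN n).2%:R^-1).
      rewrite /freq /F.
      apply: (@avg_interval_shift R _ _ (fun m => \1_C (iter m bshift a))) => // m.
      by rewrite indicE ler0n lern1 leq_b1.
    by rewrite lef_pV2 ?posrE ?ltr0n// ler_nat; exact: (MNP n).1.
  by move=> H V /H; exact: oU.
have [mu [muL mushift]] := cylinder_measure_extension L_ge0 LT LU Lshift.
(* Diagonal choice: [s m] approximates [L] on all cylinders of level [m] at once. *)
have /choice[s sP] : forall m, exists n, (m <= n)%N /\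
    forall C, cylinder m C -> `|L C - freq C n| < m.+1%:R^-1.
  move=> m.
  have Um : U [set n | (m <= n)%N] by apply: oU; exists m.
  have UC : U [set n | forall C, cylinder m C -> `|L C - freq C n| < m.+1%:R^-1].
    have /finite_fsetP[Y YE] := @finite_cylinders R m.
    have : U (\bigcap_(C in [set` Y]) [set n | `|L C - freq C n| < m.+1%:R^-1]).
      apply: filter_bigI => C _; have m0 : 0 < m.+1%:R^-1 :> R by rewrite invr_gt0.
      by have /cvgrPdist_lt/(_ _ m0) := LP C.
    by rewrite -YE; apply: filterS => n nY C /nY.
  by have [n [/= mn nC]] := filter_ex (filterI Um UC); exists n.
have freq_cvg C : is_cylinder C -> freq C (s n) @[n --> \oo] --> L C.
  move=> [k Ck]; apply/cvgrPdist_lt => e e0; near=> m.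
  have km : (k <= m)%N by near: m; exists k.
  apply: lt_trans ((sP m).2 C (cylinderW km Ck)) _.
  by near: m; exact: (near_infty_natSinv_lt (PosNum e0)).
exists a, (F \o s), mu; split.
- by move=> n n0 /set_mem.
- apply: interval_folner => n; exact: leq_ltn_trans (sP n).1 (MNP _).1.
- by split; [exact: biseq_compact|exact: bshift_homeo|exact: mushift].
- apply: generic_cylinders => [N|C cC]; first exact: F0.
  by rewrite muL//=; exact: freq_cvg.
have cE : is_cylinder [set x : biseq R | x 0].
  by exists 1%N => x y xy /=; rewrite xy.
(* Coordinate 0 of the [m]-th shift of [a] is membership of [m] in [A], so all frequencies of this
   cylinder are at least [c]. *)
rewrite muL// lte_fin (lt_le_trans c0)//.
apply: (cvgr_to_ge (LP _)).
apply: (@filterE _ U) => n /=; apply: le_trans (MNP n).2 _.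
apply: le_avg => m; rewrite ler_nat.
case: (boolP (m \in A)) => // mA; rewrite mem_set//= iter_bshift add0r.
exact: mA.
Unshelve. all: by end_near.
Qed.

(** * Sumsets from elements of the adherence semigroup *)

Lemma adherence_infinite_ksums (X : uniformType) (T : X -> X) (a : X) (E : set X)
    (p : {ptws X -> X}) (k t : nat) :
  continuous T -> open E -> adherence_semigroup T p ->
  E (iter t T (iter k (p : X -> X) a)) ->
  exists B : set nat, [/\ B `<=` posN, infinite_set B &
    forall n, ksums B k n -> E (iter (n + t) T a)].
Proof.
move=> cT oE pA Ek.
have cTn := continuous_iter cT.
(* [good G] is the greedy invariant; taking [#|F| = k] gives the conclusion. *)
pose good (G : {fset nat}) := [set` G] `<=` posN /\
  forall F : {fset nat}, (F `<=` G)%fset -> (#|` F| <= k)%N%fset ->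
    E (iter (\sum_(n <- F) n + t)%N T (iter (k - #|` F|%fset) (p : X -> X) a)).
have good0 : good fset0.
  split; first by move=> n /=; rewrite inE.
  move=> F; rewrite fsubset0 => /eqP -> _.
  by rewrite big_seq_fset0 cardfs0 subn0.
have step (G : {fset nat}) : good G -> exists n, n \notin G /\ good (n |` G)%fset.
  move=> [Gpos gG].
  (* [V F] asks that the point of [F] stay in [E] when its outermost [p] becomes [q]; it is vacuous
     once no [p] is left. The finitely many subsets of [G] give a single neighbourhood of [p]. *)
  pose V (F : {fset nat}) : set {ptws X -> X} := [set q : {ptws X -> X} |
    (#|` F|%fset < k)%N ->
    E (iter (\sum_(n <- F) n + t)%N T
      ((q : X -> X) (iter (k - #|` F|%fset).-1 (p : X -> X) a)))].
  have nV : nbhs p (\bigcap_(F in [set` fpowerset G]) V F).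
    apply: filter_bigI => F; rewrite fpowersetE => FG.
    have [Fk|kF] := ltnP #|` F|%fset k; last first.
      by apply: (@filterE _ (nbhs p)) => q /=; rewrite /V /= ltnNge kF.
    have pid : {ptws, nbhs p --> (p : X -> X)} by [].
    move/pointwise_cvgP : pid => /(_ (iter (k - #|` F|%fset).-1 (p : X -> X) a)) pid.
    set y := iter _ (p : X -> X) a in pid *.
    have Ey : E (iter (\sum_(n <- F) n + t)%N T ((p : X -> X) y)).
      by have := gG F FG (ltnW Fk); rewrite -(prednK (n := k - _)) ?subn_gt0//.
    have pE := continuous_cvg _ (cTn (\sum_(n <- F) n + t)%N _) pid.
    have Vp : nbhs p [set q : {ptws X -> X} |
        E (iter (\sum_(n <- F) n + t)%N T ((q : X -> X) y))].
      exact: (pE (nbhs_filter p) E (open_nbhs_nbhs (conj oE Ey))).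
    by apply: filterS Vp => q /= qE _.
  (* The iterate is taken later than the sum of [G], so that [n] is positive and outside [G]. *)
  have [|q [[n /= nG <-] nVn]] := pA (\sum_(n <- G) n).+1 _ _ nV.
    by [].
  have nnG : n \notin G.
    by apply/negP => nG'; move: nG; rewrite (big_fsetD1 n nG') /=; lia.
  exists n; split => //; split.
    by move=> m /=; rewrite !inE => /orP[/eqP->|/Gpos//]; rewrite /posN /=; lia.
  move=> F FG Fk; have [nF|nF] := boolP (n \in F); last first.
    apply: gG => //; apply/fsubsetP => m mF; have /fsubsetP/(_ m mF) := FG.
    by rewrite !inE => /orP[/eqP mn|//]; rewrite -mn mF in nF.
  have FE : F = (n |` (F `\ n))%fset by rewrite fsetD1K.
  have F'G : (F `\ n `<=` G)%fset by rewrite fsubDset.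
  have cF : #|` F|%fset = (#|` F `\ n|%fset).+1 by rewrite (cardfsD1 n) nF.
  have := nVn (F `\ n)%fset; rewrite /V /= fpowersetE => /(_ F'G).
  rewrite -cF => /(_ Fk).
  by rewrite -iterD (big_fsetD1 n nF) /= cF subnS addnAC [(_ + n)%N]addnC.
(* The invariant travels with the set, so the step can be iterated as a function. *)
have /choice[f fP] : forall G : {G | good G}, exists G' : {G | good G},
    exists2 n, n \notin sval G & sval G' = (n |` sval G)%fset.
  move=> [G gG]; have [n [nG gnG]] := step G gG.
  by exists (exist _ _ gnG); exists n.
pose G i := sval (iter i f (exist _ _ good0)).
have GS i : exists2 n, n \notin G i & G i.+1 = (n |` G i)%fset by exact: fP.
have gG i : good (G i) by exact: svalP.
have cG i : #|` G i|%fset = i.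
  elim: i => [|i IH]; first exact: cardfs0.
  by have [n nG ->] := GS i; rewrite cardfsU1 nG IH.
have Gle i j : (i <= j)%N -> (G i `<=` G j)%fset.
  move=> /subnK <-; elim: (j - i)%N => [|d IH]; first exact: fsubset_refl.
  have [n _ /= GE] := GS (d + i)%N.
  by rewrite addSn GE; apply: fsubset_trans IH _; exact: fsubsetU1.
pose B := \bigcup_i [set` G i].
have BF (F : {fset nat}) : [set` F] `<=` B -> exists i, (F `<=` G i)%fset.
  move=> FB; have /choice[j jP] : forall n, exists i, n \in F -> n \in G i.
    move=> n; have [nF|_] := boolP (n \in F); last by exists 0%N.
    by have [i _ /= niG] := FB n nF; exists i.
  (* This sum bounds every stage [j n] with [n] in [F], and the sets [G i] increase. *)
  exists (\sum_(n <- F) j n)%N; apply/fsubsetP => n nF.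
  apply: (fsubsetP (Gle (j n) _ _)); last exact: jP.
  by rewrite (big_fsetD1 n)//= leq_addr.
exists B; split.
- by move=> n [i _]; exact: (gG i).1.
(* A finite [B] would lie in some [G i], yet it contains [G i.+1], which has one more element. *)
- move=> /finite_fsetP[F BE].
  have [i Fi] : exists i, (F `<=` G i)%fset by apply: BF; rewrite BE.
  have : (G i.+1 `<=` F)%fset.
    apply/fsubsetP => n nG; have Bn : B n by exists i.+1.
    by rewrite BE in Bn.
  move=> GF; have := fsubset_leq_card (fsubset_trans GF Fi).
  by rewrite !cG ltnn.
- move=> _ [F [/BF[i Fi] cF] <-].
  by have := (gG i).2 F Fi; rewrite cF leqnn subnn; apply.
Qed.

Theorem proposition3p7 (R : realType) (k : nat) (hk : (0 < k)%N) :
  (forall A : set nat, A `<=` posN -> (0 < upper_banach_density R A)%E ->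
     exists (B : set nat) (t : nat),
       [/\ B `<=` posN, infinite_set B & ksums B k `<=` shiftN A t])
  <->
  (forall (X : pmetricType R) (mu : probability (borel X) R) (T : X -> X),
     is_system mu T ->
     forall Phi : nat -> {fset nat}, is_folner R Phi ->
     forall a : X, generic mu T Phi a ->
     forall E : set X, open E -> (0 < mu E)%E ->
     exists (p : {ptws X -> X}) (t : nat),
       adherence_semigroup T p /\ (iter t T @^-1` E) (iter k (p : X -> X) a)).
Proof.
split.
  move=> HC X mu T [cX [cT _] _] Phi fol a gen E oE E0.
  (* The sumset property is applied to the visiting times of [E']; the closed set [K] retains the
     limit points inside [E]. *)
  have [E' [K [E'K cK KE dE']]] := generic_visits fol gen oE E0.
  have [|B [t [_ iB Bt]]] := HC _ _ dE'; first by move=> n [].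
  have [|p [pA pK]] := @adherence_ksums R X T a K B k t cX cT cK iB.
    by move=> n /Bt [_ [_ /E'K]].
  by exists p, t; split => //; exact: KE.
move=> HD A Apos dA.
have [a [Phi [mu [aA fol sys gen E0]]]] := correspondence dA.
have oE : open [set x : biseq R | x 0].
  by apply: cylinder_open; exists 1%N => x y xy /=; rewrite xy.
have [p [t [pA pE]]] := HD _ _ _ sys _ fol _ gen _ oE E0.
have [B [Bpos iB BE]] := adherence_infinite_ksums bshift_homeo.1 oE pA pE.
exists B, t; split => // n nB.
(* Since [k] is positive, [n] is a nonempty sum of positive integers, as membership in [shiftN]
   demands. *)
have n0 : (0 < n)%N.
  case: nB => F [FB cF] <-.
  have : F != fset0 by rewrite -cardfs_gt0 cF.
  move=> /fset0Pn[m mF]; rewrite (big_fsetD1 m)//= addn_gt0.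
  by rewrite (Bpos m (FB m mF)).
split => //; have := BE n nB; rewrite /= iter_bshift add0r; apply: aA.
by rewrite addn_gt0 n0.
Qed.
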